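(* Let $G=(V,E)$ be a finite simple graph with maximum degree $\Delta$, let $F=\mathbb{R}$ or $F=\mathbb{C}$, and let $S$ be a zero forcing set of $G$ with propagation time $\tau=pt(G,S)$. Let $\varepsilon>0$. Then for every $\mathbf{A}\in\mathcal{S}_F(G)$ there is a map $\Phi_{\mathbf{A}}:F^{S}\to F^{V}$ (depending only on $\mathbf{A}$ and $S$) such that for all $\mathbf{x}\in F^V$ with $\mathbf{A}\mathbf{x}=\mathbf{0}$ and all $\mathbf{x}'\in F^V$ with $\|\mathbf{x}-\mathbf{x}'\|_\infty<\varepsilon$, the vector $\hat{\mathbf{x}}:=\Phi_{\mathbf{A}}(\mathbf{x}'_S)$ satisfies $\hat{\mathbf{x}}_S=\mathbf{x}'_S$ and \[\|\mathbf{x}-\hat{\mathbf{x}}\|_\infty\le[\kappa'(\mathbf{A})\,\Delta]^{\tau}\,\varepsilon.\]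
   Context: Zero forcing: starting with the vertices of a set $S$ colored, the color change rule says that if a colored vertex $u$ has exactly one uncolored neighbor $v$, then $v$ becomes colored ($u$ forces $v$); $S$ is a zero forcing set if repeated application colors all vertices. Propagation time: set $S_0=S$ and let $S_{t+1}$ be $S_t$ together with every vertex $v\notin S_t$ that is the unique neighbor outside $S_t$ of some vertex $u\in S_t$ (all such forces done simultaneously); $pt(G,S)$ is the least $\tau$ with $S_\tau=V$. $\mathcal{S}_F(G)$ is the set of $|V|\times|V|$ matrices $\mathbf{A}$ over $F$ with, for $i\neq j$, $\mathbf{A}_{ij}=0$ if $\{i,j\}\notin E$ and $\mathbf{A}_{ij}\neq0$ if $\{i,j\}\in E$, diagonal entries arbitrary. $\mathbf{x}_S$ denotes the entries of $\mathbf{x}$ indexed by $S$. The multiplicative row-support spread of a matrix $\mathbf{A}$ is $\kappa'(\mathbf{A})=\max_{i,j,k}|\mathbf{A}_{ij}/\mathbf{A}_{ik}|$, the maximum over triples with $\mathbf{A}_{ij}\neq0$ and $\mathbf{A}_{ik}\neq0$; by convention $\kappa'$ of a zero matrix is $1$. *)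

(* Defs.v *)
From HB Require Import structures.
From mathcomp Require Export all_boot all_order all_algebra.
From mathcomp Require Export complex reals normedtype.

Set Implicit Arguments.
Unset Strict Implicit.
Unset Printing Implicit Defensive.

Import Order.TTheory GRing.Theory Num.Theory.

Local Open Scope ring_scope.

Section Graph.
Variables (V : finType) (e : rel V).

Definition neighbors (v : V) : {set V} := [set w | e v w].

Definition max_degree : nat := (\max_(v : V) #|neighbors v|)%N.

Definition forces (C : {set V}) (u v : V) : bool :=
  (u \in C) && (neighbors u :\: C == [set v]).

(* The colorings obtainable from S by applying the color change rule one
   force at a time, in any order. *)
Inductive reachable (S : {set V}) : {set V} -> Prop :=
| reachable_start : reachable S S
| reachable_force (C : {set V}) (u v : V) :
    reachable S C -> forces C u v -> reachable S (v |: C).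

Definition zero_forcing_set (S : {set V}) : Prop := reachable S [set: V].

Definition prop_step (C : {set V}) : {set V} :=
  C :|: [set v | [exists u, forces C u v]].

Definition colored_at (S : {set V}) (t : nat) : {set V} := iter t prop_step S.

Definition is_propagation_time (S : {set V}) (tau : nat) : Prop :=
  colored_at S tau = [set: V] /\
  (forall t : nat, colored_at S t = [set: V] -> (tau <= t)%N).

End Graph.

Section Matrices.
Variable F : numFieldType.

(* Rows and columns of a #|V| x #|V| matrix are labelled by the vertices
   through the bijection enum_rank : V -> 'I_#|V|. *)
Definition graph_matrix (V : finType) (e : rel V) (A : 'M[F]_#|V|) : Prop :=
  forall i j : V, i != j ->
    (~~ e i j -> A (enum_rank i) (enum_rank j) = 0) /\
    (e i j -> A (enum_rank i) (enum_rank j) <> 0).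

(* F^S is 'cV[F]_#|S|, the elements of S being listed by enum_val. *)
Definition restr_vec (V : finType) (S : {set V}) (x : 'cV[F]_#|V|) :
    'cV[F]_#|S| :=
  \col_(s < #|S|) x (enum_rank (enum_val s)) 0.

(* Moduli take values in F itself, on the nonnegative reals of F, where
   Num.max is the usual maximum; the base 0 is neutral there, and for A != 0
   the range of the maximum is nonempty. *)
Definition row_support_spread (m n : nat) (A : 'M[F]_(m, n)) : F :=
  if A == 0 then 1 else
  \big[Num.max/0]_(t : 'I_m * 'I_n * 'I_n |
      (A t.1.1 t.1.2 != 0) && (A t.1.1 t.2 != 0))
    `|A t.1.1 t.1.2 / A t.1.1 t.2|.

End Matrices.

(* Main.v *)
Require Import Defs.
From mathcomp Require Import all_boot all_order all_algebra.
From mathcomp Require Import interval_inference complex reals normedtype.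

(** If [u] forces [v], the [u]-th equation of [A x = 0] expresses [x_v] through
    the at most [Delta] coordinates indexed by the other elements of the closed
    neighborhood of [u], all coloured before [v], with coefficients of modulus
    at most [kappa' A].  Each propagation step therefore multiplies the error
    on the coloured coordinates by at most [kappa' A * Delta].  This factor is
    at least [1] as soon as the graph has an edge, so the coordinates coloured
    earlier satisfy the later bounds too; without edges [tau = 0]. *)

Set Implicit Arguments.
Unset Strict Implicit.
Unset Printing Implicit Defensive.

Import Order.TTheory GRing.Theory Num.Theory.

Local Open Scope ring_scope.
Local Open Scope complex_scope.

(** The order of [F] may be partial, as over the complex numbers; nonnegative elements are real and
    hence pairwise comparable, which is all that [Num.max] needs. *)
Lemma le_bigmax_ge0 (F : numDomainType) (I : eqType) (r : seq I) (P : pred I)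
    (f : I -> F) (i : I) :
  (forall j, P j -> 0 <= f j) -> i \in r -> P i ->
  f i <= \big[Num.max/0]_(j <- r | P j) f j.
Proof.
move=> f0 + Pi; have freal j : P j -> f j \is Num.real by move=> /f0/ger0_real.
elim: r => // k r IHr; rewrite inE big_cons => /predU1P[<-|/IHr le_fi].
  by rewrite Pi comparable_le_max ?lexx// real_comparable ?freal// bigmax_real.
case: ifP => // Pk; rewrite comparable_le_max ?le_fi ?orbT//.
by rewrite real_comparable ?freal// bigmax_real.
Qed.

Section MatrixNorm.
Variables (F : numFieldType) (m n : nat).
Implicit Types x : 'M[F]_(m, n).

Lemma norm_mx_le x (b : F) :
  0 <= b -> (forall i j, `|x i j| <= b) -> `|x| <= b.
Proof.
move=> b0 xb; rewrite [leLHS]/Num.norm/= mx_normE.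
by elim/big_ind: _ => //= c d cb db; case: (leP c d).
Qed.

Lemma norm_coef_le x i j : `|x i j| <= `|x|.
Proof.
rewrite [leRHS]/Num.norm/= mx_normE -[leLHS]nngE num_le.
exact: (le_bigmax _ (fun k : 'I_m * 'I_n => `|x k.1 k.2|%:nng) (i, j)).
Qed.

Lemma ratio_le_row_support_spread (A : 'M[F]_(m, n)) i j k :
  A i j != 0 -> A i k != 0 -> `|A i j / A i k| <= row_support_spread A.
Proof.
move=> Aij Aik; rewrite /row_support_spread; case: ifPn => [/eqP A0|_].
  by rewrite A0 mxE eqxx in Aij.
pose f (t : 'I_m * 'I_n * 'I_n) := `|A t.1.1 t.1.2 / A t.1.1 t.2|.
apply: (@le_bigmax_ge0 _ _ _ _ f (i, j, k)) => [t _||]; first exact: normr_ge0.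
  exact: mem_index_enum.
by rewrite /= Aij.
Qed.

End MatrixNorm.

Section Reconstruction.
Variables (F : numFieldType) (V : finType) (e : rel V) (A : 'M[F]_#|V|).
Hypothesis A_graph : graph_matrix e A.

Local Notation a u v := (A (enum_rank u) (enum_rank v)).
Local Notation kappa := (row_support_spread A).
Local Notation Delta := (max_degree e).

Definition solve_row (y : V -> F) (u v : V) : F :=
  - (a u v)^-1 * \sum_(w | w != v) a u w * y w.

(** The forcing vertex is picked from the graph and [S] alone, never from [y]. The default 0 only
    reaches vertices still uncoloured after the step, on which no error bound is claimed. *)
Fixpoint reconstruct (S : {set V}) (y : V -> F) (t : nat) : V -> F :=
  if t is t'.+1 then
    let C := colored_at e S t' in let z := reconstruct S y t' in
    fun v => if v \in C then z v else
             if [pick u | forces e C u v] is Some u then solve_row z u v else 0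
  else y.

Lemma sum_row_eq0 (x : 'cV[F]_#|V|) (u : V) :
  A *m x = 0 -> \sum_w a u w * x (enum_rank w) 0 = 0.
Proof.
move=> /matrixP /(_ (enum_rank u) 0); rewrite !mxE => Axu.
rewrite -[RHS]Axu [RHS](reindex (@enum_rank V))//=.
exact: onW_bij (@enum_rank_bij V).
Qed.

Lemma edge_neq0 (u v : V) : u != v -> e u v -> a u v != 0.
Proof. by move=> uv euv; have [_ /(_ euv)/eqP] := A_graph uv. Qed.

Lemma forcesP (C : {set V}) (u v : V) :
  forces e C u v -> [/\ u \in C, e u v, v \notin C &
    forall w, e u w -> w != v -> w \in C].
Proof.
case/andP=> uC /eqP/setP NuC; have:= NuC v.
rewrite !inE eqxx => /andP[vC euv]; split=> // w euw wv.
by have:= NuC w; rewrite !inE euw (negbTE wv) andbT => /negbFE.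
Qed.

Lemma solve_row_error (x : 'cV[F]_#|V|) (y : V -> F) (C : {set V}) (u v : V)
    (b : F) :
  A *m x = 0 -> forces e C u v -> 0 <= b ->
  (forall w, w \in C -> `|x (enum_rank w) 0 - y w| <= b) ->
  `|x (enum_rank v) 0 - solve_row y u v| <= kappa * Delta%:R * b.
Proof.
move=> Ax0 /forcesP[uC euv vC NC] b0 xyb.
have uv : u != v by apply: contraNneq vC => <-.
have auv := edge_neq0 uv euv.
have kappa0 : 0 <= kappa.
  exact: le_trans (normr_ge0 _) (ratio_le_row_support_spread auv auv).
(* [B] holds every index other than [v] at which row [u] can be nonzero. It contains [u] itself,
   since the diagonal entry is arbitrary. *)
pose B := (u |: neighbors e u) :\ v.
have -> : x (enum_rank v) 0 - solve_row y u v =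
    - \sum_(w in B) a u w / a u v * (x (enum_rank w) 0 - y w).
  (* The exact solution is a fixed point of the same formula, so the error at [v] is linear in the
     errors on [B]. *)
  have -> : x (enum_rank v) 0 = solve_row (fun w => x (enum_rank w) 0) u v.
    have/eqP := sum_row_eq0 u Ax0; rewrite (bigD1 v)//= addrC addr_eq0.
    by rewrite /solve_row => /eqP->; rewrite mulrNN mulKf.
  rewrite /solve_row !mulNr -opprD -mulrBr -sumrB mulr_sumr; congr (- _).
  rewrite [LHS](bigID (mem B))/= [X in _ + X]big1 ?addr0 => [|w].
    apply: eq_big => [w|w _]; first by rewrite !inE; case: (w != v).
    by rewrite -mulrBr mulrA [_^-1 * _]mulrC.
  rewrite !inE => /andP[-> /=]; rewrite negb_or eq_sym => /andP[uw nuw].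
  have [-> // _] := A_graph uw.
  by rewrite !mul0r subrr mulr0.
rewrite normrN; apply: le_trans (ler_norm_sum _ _ _) _.
apply: (@le_trans _ _ (\sum_(w in B) kappa * b)).
  apply: ler_sum => w; rewrite !inE => /andP[wv wB].
  have wC : w \in C by case/predU1P: wB => [->//|/NC]; exact.
  (* A zero coefficient can only be the diagonal one; the spread does not range over it, but its
     term vanishes. *)
  rewrite normrM; have [->|auw] := eqVneq (a u w) 0.
    by rewrite mul0r normr0 mul0r mulr_ge0.
  by rewrite ler_pM ?xyb// ratio_le_row_support_spread.
rewrite sumr_const -[leLHS]mulr_natl mulrCA -mulrA.
rewrite ler_wpM2l// ler_wpM2r// ler_nat.
(* Adjoining [u] adds at most one element and removing [v] takes one away, so [B] has at most as
   many elements as [neighbors e u]. *)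
have vN : v \in u |: neighbors e u by rewrite !inE euv orbT.
apply: (@leq_trans #|neighbors e u|); last exact: leq_bigmax.
have := cardsD1 v (u |: neighbors e u); rewrite vN cardsU1 -/B => cardB.
by rewrite -(leq_add2l 1) -[leqLHS]cardB leq_add2r leq_b1.
Qed.

Lemma reconstruct_on_start (S : {set V}) (y : V -> F) (t : nat) (v : V) :
  v \in S -> reconstruct S y t v = y v.
Proof.
move=> vS; elim: t => //= t ->; case: ifPn => // /negP[].
by elim: t => //= t IHt; rewrite inE IHt.
Qed.

Lemma reconstruct_error (S : {set V}) (x : 'cV[F]_#|V|) (y : V -> F) (eps : F)
    (t : nat) :
  A *m x = 0 -> 0 <= eps -> 1 <= kappa * Delta%:R ->
  (forall v, v \in S -> `|x (enum_rank v) 0 - y v| <= eps) ->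
  forall v, v \in colored_at e S t ->
    `|x (enum_rank v) 0 - reconstruct S y t v| <=
      (kappa * Delta%:R) ^+ t * eps.
Proof.
set K := kappa * _ => Ax0 eps0 K1 xy; have K0 : 0 <= K := le_trans ler01 K1.
elim: t => [v vS|t IHt v /=]; first by rewrite expr0 mul1r xy.
have b0 : 0 <= K ^+ t * eps by rewrite mulr_ge0// exprn_ge0.
rewrite exprS -mulrA inE; case: ifP => /= [vC _|_].
  by apply: le_trans (IHt v vC) _; rewrite ler_peMl.
rewrite inE => /existsP[u0 u0v].
case: pickP => [u uv|/(_ u0)]; last by rewrite u0v.
exact: solve_row_error uv b0 IHt.
Qed.

(** The ratio of a nonzero entry to itself already gives spread at least 1, and [u] has a
    neighbor. *)
Lemma spread_degree_ge1 (u v : V) :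
  u != v -> e u v -> 1 <= kappa * Delta%:R.
Proof.
move=> uv euv; have auv := edge_neq0 uv euv.
have := ratio_le_row_support_spread auv auv; rewrite divff// normr1 => k1.
apply: mulr_ege1 => //; rewrite ler1n.
apply: leq_trans (leq_bigmax u); apply/card_gt0P; exists v.
by rewrite inE.
Qed.

End Reconstruction.

Lemma colored_at_no_force (V : finType) (e : rel V) (S : {set V}) (t : nat) :
  (forall u v, ~~ forces e S u v) -> colored_at e S t = S.
Proof.
move=> noforce; elim: t => //= t ->; apply/setP => v; rewrite !inE.
by rewrite [X in _ || X](introF existsP) ?orbF// => -[u]; apply/negP.
Qed.

(* `|x| on column vectors is the library's matrix norm, i.e. the sup norm. *)
Theorem theorem1 (R : realType) (F : numFieldType)
    (F_real_or_complex : F = (R : numFieldType) \/ F = (R[i] : numFieldType))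
    (V : finType) (e : rel V) (e_sym : symmetric e) (e_irr : irreflexive e)
    (S : {set V}) (S_zf : zero_forcing_set e S)
    (tau : nat) (S_pt : is_propagation_time e S tau)
    (A : 'M[F]_#|V|) (A_graph : graph_matrix e A) :
  exists Phi : 'cV[F]_#|S| -> 'cV[F]_#|V|,
    forall eps : F, 0 < eps ->
    forall x x' : 'cV[F]_#|V|, A *m x = 0 -> `|x - x'| < eps ->
      restr_vec S (Phi (restr_vec S x')) = restr_vec S x' /\
      `|x - Phi (restr_vec S x')|
        <= (row_support_spread A * (max_degree e)%:R) ^+ tau * eps.
Proof.
have [S_tau tau_min] := S_pt.
(* Extension by 0 outside [S]; a force multiplies these placeholders only by zero coefficients. *)
pose ext (y : 'cV[F]_#|S|) (v : V) : F :=
  if [pick s | enum_val s == v] is Some s then y s 0 else 0.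
have extE x' v : v \in S -> ext (restr_vec S x') v = x' (enum_rank v) 0.
  move=> vS; rewrite /ext; case: pickP => [s /eqP<-|]; first by rewrite mxE.
  by move=> /(_ (enum_rank_in vS v)); rewrite enum_rankK_in ?eqxx.
exists (fun y => \col_i reconstruct e A S (ext y) tau (enum_val i)).
move=> eps eps0 x x' Ax0 xx'; split.
  apply/colP => s; rewrite !mxE enum_rankK reconstruct_on_start ?extE//;
  exact: enum_valP.
have err v : v \in S -> `|x (enum_rank v) 0 - ext (restr_vec S x') v| <= eps.
  move=> vS; rewrite extE//; apply: le_trans (ltW xx').
  by have := norm_coef_le (x - x') (enum_rank v) 0; rewrite !mxE.
set K := row_support_spread A * _.
(* Nonnegativity is carried along because [norm_mx_le] asks for it: entrywise bounds do not give it
   when [V] is empty. *)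
suff [K0 main] : 0 <= K ^+ tau * eps /\ forall v, `|x (enum_rank v) 0
    - reconstruct e A S (ext (restr_vec S x')) tau v| <= K ^+ tau * eps.
  apply: norm_mx_le => // i j; rewrite ord1 !mxE.
  by have := main (enum_val i); rewrite enum_valK.
(* A first force supplies an edge, hence [1 <= K]. Otherwise the colouring never grows, so [S] is
   everything and minimality gives [tau = 0]; there [K] may be 0, but its power is 1. *)
have [/existsP[u /existsP[v uv]]|noforce] :=
    boolP [exists u, exists v, forces e S u v].
  have [uS euv vS _] := forcesP uv.
  have K1 : 1 <= K.
    by apply: (spread_degree_ge1 A_graph _ euv); apply: contraNneq vS => <-.
  split; first by rewrite mulr_ge0 ?exprn_ge0 ?(le_trans ler01 K1)// ltW.
  move=> w; apply: reconstruct_error => //; first exact: ltW.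
  by rewrite S_tau inE.
have S_all : S = [set: V].
  rewrite -S_tau colored_at_no_force// => u v.
  by apply: contraNN noforce => uv; apply/existsP; exists u; apply/existsP; exists v.
have -> : tau = 0 by apply/eqP; rewrite -leqn0; exact: tau_min.
by rewrite expr0 mul1r ltW//; split=> // v; apply: err; rewrite S_all inE.
Qed.
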